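(* Let $n$ and $k\ge2$ be integers with $k$ dividing $n$. Then the deterministic query complexity of the partial function $\mathrm{1vKCycle}$ on $n$ vertices satisfies $D(\mathrm{1vKCycle})\ge\frac{n^2}{128k^2}$.
   Context: Undirected graphs on vertex set $\{1,\dots,n\}$ are encoded as strings in $\{0,1\}^N$ with $N=\binom n2$, one bit per unordered pair indicating whether the edge is present. The partial function $\mathrm{1vKCycle}:\Delta\to\{0,1\}$ is defined on the set $\Delta\subseteq\{0,1\}^N$ of graphs that are either a single cycle of length $n$ (Hamiltonian cycle) or a disjoint union of $k$ cycles each of length $n/k$; it maps the former to $1$ and the latter to $0$. For a partial function $g:\Delta\to\{0,1\}$, $D(g)=\min\{D(f): f:\{0,1\}^N\to\{0,1\},\ f|_\Delta=g\}$, where $D(f)$ for total $f$ is the minimum depth of a deterministic decision tree computing $f$.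
   Formalization: The formal theorem adds the hypothesis n ≥ 3k (cycle length n/k at least 3); for n = k or n = 2k simple graphs have no cycles of length n/k, so D = 0 and the stated bound fails; the trivial case n = 0 is also excluded. *)

(* Defs.v *)
From Stdlib Require Import ClassicalEpsilon.
From mathcomp Require Import all_boot all_order all_algebra.
Set Implicit Arguments. Unset Strict Implicit. Unset Printing Implicit Defensive.

Definition classicb (P : Prop) : bool :=
  if excluded_middle_informative P then true else false.

Lemma classicbP (P : Prop) : reflect P (classicb P).
Proof. rewrite /classicb; case: excluded_middle_informative => h; by constructor. Qed.

Inductive dtree (I : Type) : Type :=
| DLeaf of bool
| DNode of I & dtree I & dtree I.

Fixpoint dt_eval (I : finType) (t : dtree I) (x : {ffun I -> bool}) : bool :=
  match t with
  | DLeaf b => b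
  | DNode i t0 t1 => if x i then dt_eval t1 x else dt_eval t0 x
  end.

Fixpoint dt_depth (I : Type) (t : dtree I) : nat :=
  match t with
  | DLeaf _ => 0
  | DNode _ t0 t1 => (maxn (dt_depth t0) (dt_depth t1)).+1
  end.

Definition dt_computes (I : finType) (t : dtree I) (f : {ffun I -> bool} -> bool) :=
  forall x, dt_eval t x = f x.

Section FullTree.
Variables (I : finType) (f : {ffun I -> bool} -> bool).

Definition upd (a : {ffun I -> bool}) (i : I) (b : bool) : {ffun I -> bool} :=
  [ffun j => if j == i then b else a j].

Fixpoint build (s : seq I) (a : {ffun I -> bool}) : dtree I :=
  match s with
  | [::] => DLeaf I (f a)
  | i :: s' => DNode i (build s' (upd a i false)) (build s' (upd a i true))
  end.

Lemma build_eval s a x :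
  dt_eval (build s a) x = f [ffun j => if j \in s then x j else a j].
Proof.
elim: s a => [|i s IH] a /=.
  by congr f; apply/ffunP => j; rewrite !ffunE.
have -> : (if x i then dt_eval (build s (upd a i true)) x
           else dt_eval (build s (upd a i false)) x)
          = dt_eval (build s (upd a i (x i))) x by case: (x i).
rewrite IH; congr f; apply/ffunP => j; rewrite !ffunE in_cons.
case: (j \in s); first by rewrite orbT.
by rewrite orbF; case: eqP => // ->.
Qed.

Lemma build_depth s a : dt_depth (build s a) = size s.
Proof. by elim: s a => [|i s IH] a //=; rewrite !IH maxnn. Qed.

Lemma exists_tree : exists t : dtree I, dt_depth t <= #|I| /\ dt_computes t f.
Proof.
exists (build (enum I) [ffun => false]); split.
  by rewrite build_depth -cardE.
move=> x; rewrite build_eval; congr f; apply/ffunP => j.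
by rewrite !ffunE mem_enum.
Qed.
End FullTree.

Definition D_total (I : finType) (f : {ffun I -> bool} -> bool) : nat :=
  ex_minn (P := fun d => classicb (exists t : dtree I, dt_depth t <= d /\ dt_computes t f))
    (let: ex_intro t h := exists_tree f in
     ex_intro _ #|I| (introT (classicbP _) (ex_intro _ t h))).

Lemma D_partial_ex (I : finType) (Delta : {ffun I -> bool} -> Prop)
      (g : {ffun I -> bool} -> bool) :
  exists d, classicb (exists f : {ffun I -> bool} -> bool,
                        (forall x, Delta x -> f x = g x) /\ D_total f = d).
Proof. by exists (D_total g); apply/classicbP; exists g. Qed.

Definition D_partial (I : finType) (Delta : {ffun I -> bool} -> Prop)
           (g : {ffun I -> bool} -> bool) : nat :=
  ex_minn (D_partial_ex Delta g).

(* unordered pair {i,j}, represented as (i,j) with i < j *)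
Definition vpair (n : nat) := {p : 'I_n * 'I_n | p.1 < p.2}.

Definition graph (n : nat) := {ffun vpair n -> bool}.

Definition adj (n : nat) (x : graph n) (i j : 'I_n) : bool :=
  [exists p : vpair n, ((val p == (i, j)) || (val p == (j, i))) && x p].

(* x is a vertex-disjoint union of m cycles, each of length L, covering all n
   vertices: each cycle is a list c of L distinct vertices, with edges
   {v, next c v} (cyclic successor), and these are all edges of x. *)
Definition cycle_union (n : nat) (x : graph n) (m L : nat) : Prop :=
  exists cs : seq (seq 'I_n),
    [/\ size cs = m,
        all (fun c => size c == L) cs,
        perm_eq (flatten cs) (enum 'I_n) &
        forall i j : 'I_n,
          adj x i j = has (fun c => (i \in c) && ((next c i == j) || (next c j == i))) cs].

Definition ham_cycle (n : nat) (x : graph n) : Prop := cycle_union x 1 n.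

Definition k_cycles (n k : nat) (x : graph n) : Prop := cycle_union x k (n %/ k).

Definition oneVKCycle_dom (n k : nat) (x : graph n) : Prop :=
  ham_cycle x \/ k_cycles k x.

Definition oneVKCycle (n : nat) (x : graph n) : bool := classicb (ham_cycle x).

(* Main.v *)
(** Write m = n / k.  The adversary maintains the list N of edges answered "no"
    and a single path P all of whose edges are answered "yes"; every edge not on
    P is answered "no".  As soon as a vertex meets T = max(1, m / 8) edges of N it
    is made an interior vertex of P, at the cost of at most three vertices of P.
    After d < m^2 / 128 queries there are at most 2d / T such heavy vertices, so P
    has fewer than m vertices, and the ends of P and the vertices off P meet fewer
    than T edges of N.  Such vertices can be arranged in cycles of any length
    >= m avoiding N: walk greedily for 2(T - 1) steps, close up, and insert each
    remaining vertex between two consecutive ones to which it is not N-adjacent.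
    Hence P extends both to a Hamiltonian cycle and to k cycles of length m, and
    the answers do not separate the two. *)
Require Import Defs.
From mathcomp Require Import all_boot all_order all_algebra zify.

Set Implicit Arguments.
Unset Strict Implicit.
Unset Printing Implicit Defensive.

(** * Paths and cycles avoiding a relation of bounded degree *)

Section Connecting.
Variables (T : eqType) (nadj : rel T) (D : nat).

Notation good := (fun a b => ~~ nadj a b).

(** Degree at most [D], measured on duplicate-free lists because [T] is only an [eqType]. *)
Definition low (a : T) := forall s, uniq s -> count (nadj a) s <= D.

Lemma low_avoid a r : low a -> uniq r -> D < size r ->
  exists2 v, v \in r & ~~ nadj a v.
Proof.
move=> la ur szr.
have /hasP[v vr nv] : has (predC (nadj a)) r.
  by rewrite has_count; have := count_predC (nadj a) r; have := la r ur; lia.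
by exists v.
Qed.

Lemma low_avoid2 a b r : low a -> low b -> uniq r -> D + D < size r ->
  exists v, [/\ v \in r, ~~ nadj a v & ~~ nadj b v].
Proof.
move=> la lb ur szr.
have /hasP[v vr /= nv] : has (predC (predU (nadj a) (nadj b))) r.
  rewrite has_count; have := count_predC (predU (nadj a) (nadj b)) r.
  have := count_predUI (nadj a) (nadj b) r.
  by have := la r ur; have := lb r ur; lia.
by exists v; move: nv; rewrite negb_or => /andP[].
Qed.

Lemma greedy_path j a r : {in a :: r, forall v, low v} -> uniq r ->
  j + D <= size r ->
  exists q r', [/\ perm_eq r (q ++ r'), size q = j & path good a q].
Proof.
elim: j a r => [|j IH] a r lr ur szr; first by exists [::], r; split.
have [|v vr nav] := low_avoid (lr a (mem_head _ _)) ur; first by lia.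
have pr := perm_to_rem vr.
have [||| q [r' [pq sq gq]]] := IH v (rem v r).
- move=> w; rewrite inE => /orP[/eqP->|/mem_rem wr];
  by apply: lr; rewrite inE ?vr ?wr orbT.
- exact: rem_uniq.
- by move/perm_size: pr => /=; lia.
exists (v :: q), r'; split => /=; last by rewrite nav gq.
- by rewrite (permPl pr) perm_cons.
- by rewrite sq.
Qed.

Hypothesis nadjC : symmetric nadj.

(** Pigeonhole on the [(size p).+1] gaps of the path: the two counts run over the left and the right
    ends of the gaps, so some gap has neither end [nadj] to [v]. In the induction, discarding a
    blocked first gap lowers both sides of the inequality. *)
Lemma insert_path v b p a : path good a (rcons p b) ->
  count (nadj v) (a :: p) + count (nadj v) (rcons p b) < (size p).+1 ->
  exists2 p', perm_eq p' (v :: p) & path good a (rcons p' b).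
Proof.
elim: p a => [|y p IH] a /=.
  rewrite andbT => _ szp; exists [:: v] => //=.
  by rewrite andbT (nadjC a v); case: (nadj v a) (nadj v b) szp => [] [].
move=> /andP[nay gy] szp.
have [nva|nva] := boolP (nadj v a || nadj v y).
  have [|p' pp' gp'] := IH y gy.
    by move: nva szp => /=; case: (nadj v a); case: (nadj v y) => //=; lia.
  exists (y :: p') => /=; last by rewrite nay.
  by rewrite (permPr (permEl (perm_catCA [:: v] [:: y] p))) /= perm_cons.
exists (v :: y :: p) => //=.
by move: nva; rewrite negb_or (nadjC a v) => /andP[-> ->].
Qed.

(** Each insertion lengthens [p], so [D + D <= size p] persists and bounds the two counts of
    [insert_path]. Uniqueness is asked for [a] and [b] separately, which allows [a = b], the case of
    closing a cycle at a single vertex. *)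
Lemma insert_all a b r p : {in r, forall v, low v} ->
  uniq (a :: p ++ r) -> uniq (b :: p ++ r) -> D + D <= size p ->
  path good a (rcons p b) ->
  exists2 p', perm_eq p' (p ++ r) & path good a (rcons p' b).
Proof.
elim: r p => [|v r IH] p lr ua ub szp gp; first by exists p; rewrite ?cats0.
have lv : low v by apply: lr; exact: mem_head.
have sub (c : T) : uniq (c :: p ++ v :: r) -> uniq (c :: p).
  by rewrite -cat_cons cat_uniq => /and3P[].
have [|p1 pp1 gp1] := insert_path (v := v) gp.
  have h1 := lv _ (sub _ ua).
  have : count (nadj v) (rcons p b) <= D.
    by apply: lv; rewrite rcons_uniq; exact: (sub _ ub).
  by lia.
have pc : perm_eq (p1 ++ r) (p ++ v :: r).
  apply: (perm_trans (y := (v :: p) ++ r)); first by rewrite perm_cat2r.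
  by rewrite /= -(perm_catCA p [:: v] r).
have [||||p' pp' gp'] := IH p1 _ _ _ _ gp1.
- by move=> w wr; apply: lr; rewrite inE wr orbT.
- by rewrite -(perm_uniq (s1 := a :: p ++ v :: r)) // perm_cons perm_sym.
- by rewrite -(perm_uniq (s1 := b :: p ++ v :: r)) // perm_cons perm_sym.
- by move/perm_size: pp1 => /=; lia.
by exists p' => //; exact: perm_trans pc.
Qed.

(** A greedy walk uses [D + D] vertices of [r]. More than [D + D] remain, so one of them links the
    end of the walk to [b]. The resulting interior is long enough for [insert_all] to absorb the
    rest. *)
Lemma connect_path a b r : {in [:: a, b & r], forall v, low v} ->
  uniq (a :: r) -> uniq (b :: r) -> 4 * D < size r ->
  exists2 r', perm_eq r' r & path good a (rcons r' b).
Proof.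
move=> lr ua ub szr.
have [|||q [r1 [pq sq gq]]] := @greedy_path (D + D) a r.
- by move=> v; rewrite inE => /orP[/eqP->|vr]; apply: lr; rewrite !inE ?eqxx ?vr ?orbT.
- by case/andP: ua.
- by lia.
have mr v : v \in q ++ r1 -> v \in r by rewrite (perm_mem pq).
have ur : uniq (q ++ r1) by rewrite -(perm_uniq pq); case/andP: ua.
have [||||v [vr1 nv nbv]] := @low_avoid2 (last a q) b r1.
- apply: lr; have := mem_last a q; rewrite !inE => /orP[->//|h].
  by rewrite mr ?orbT // mem_cat h.
- by apply: lr; rewrite !inE eqxx orbT.
- by move: ur; rewrite cat_uniq => /and3P[].
- by move/perm_size: pq; rewrite size_cat; lia.
have pr1 := perm_to_rem vr1.
have pr : perm_eq r (rcons q v ++ rem v r1).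
  by rewrite (permPl pq) cat_rcons perm_cat2l.
have [|||||p' pp' gp'] := @insert_all a b (rem v r1) (rcons q v).
- by move=> w /mem_rem h; apply: lr; rewrite !inE mr ?orbT // mem_cat h orbT.
- by rewrite -(perm_uniq (s1 := a :: r)) // perm_cons.
- by rewrite -(perm_uniq (s1 := b :: r)) // perm_cons.
- by rewrite size_rcons sq.
- by rewrite !rcons_path last_rcons gq nv (nadjC v b) nbv.
by exists p' => //; rewrite (permPr pr).
Qed.

(** The given path is a forced segment of the cycle; only its ends have to be [low], so its interior
    may contain heavy vertices. *)
Lemma close_cycle x p r : {in [:: x, last x p & r], forall v, low v} ->
  path good x p -> uniq (x :: p ++ r) -> 4 * D < size r ->
  exists2 r', perm_eq r' r & cycle good (x :: p ++ r').
Proof.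
move=> lr gp u szr.
have ux : uniq (x :: r).
  move: u; rewrite /= cat_uniq mem_cat negb_or => /andP[/andP[_ ->]].
  by case/and3P.
have ul : uniq (last x p :: r).
  move: u; rewrite -cat_cons lastI cat_rcons cat_uniq => /and3P[_ _].
  by [].
have [|r' pr gr] := connect_path (a := last x p) (b := x) _ ul ux szr.
  by move=> v h; apply: lr; move: h; rewrite !inE orbCA.
by exists r' => //=; rewrite rcons_cat cat_path gp.
Qed.

Lemma cycles_cover m j (s : seq T) : 4 * D + 1 < m -> {in s, forall v, low v} -> uniq s ->
  size s = j * m ->
  exists cs, [/\ size cs = j, all (fun c => size c == m) cs,
                 perm_eq (flatten cs) s & all (cycle good) cs].
Proof.
move=> hm; elim: j s => [|j IH] s ls us szs.
  by exists [::]; split=> //=; case: s szs {ls us}.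
have := cat_take_drop m s; set s1 := take m s; set s2 := drop m s => es.
have sz1 : size s1 = m by rewrite size_takel //; lia.
have sz2 : size s2 = j * m by rewrite size_drop; lia.
have := us; rewrite -es cat_uniq => /and3P[u1 _ u2].
have [v vs2|||cs [scs acs pcs ccs]] := IH s2 => //.
  by apply: ls; rewrite -es mem_cat vs2 orbT.
case E : s1 sz1 => [|x r] /= sz1; first by lia.
(* The forced segment is the single vertex [x], which is both of its ends. *)
have [v hv||||r' pr cr] := @close_cycle x [::] r => //.
- apply: ls; rewrite -es mem_cat E; move: hv; rewrite !inE /=.
  by rewrite orbA orbb => ->.
- by rewrite -E.
- by lia.
exists ((x :: r') :: cs); split => /=.
- by rewrite scs.
- by rewrite acs andbT (perm_size pr) sz1.
- by rewrite perm_cons perm_cat.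
- by rewrite ccs andbT; exact: cr.
Qed.

End Connecting.

(** * Degrees and heavy vertices for a list of edges *)

Section Graphs.
Variable n : nat.
Implicit Types (N : seq (vpair n)) (x y v w : 'I_n) (p : seq 'I_n).

Definition joins (e : vpair n) v w : bool := (val e == (v, w)) || (val e == (w, v)).

Definition nadj N v w : bool := has (fun e => joins e v w) N.

Definition touches v (e : vpair n) : bool := (v == (val e).1) || (v == (val e).2).

Definition deg N v : nat := count (touches v) N.

Lemma joinsC e v w : joins e v w = joins e w v.
Proof. by rewrite /joins orbC. Qed.

Lemma nadjC N : symmetric (nadj N).
Proof. by move=> v w; apply: eq_has => e; exact: joinsC. Qed.

Lemma count_joins e v p : uniq p -> count (joins e v) p <= touches v e.
Proof.
move=> up; case: e => -[a b] /= ab; rewrite /touches /=.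
have nab : a != b by apply/eqP => eab; move: ab; rewrite eab ltnn.
rewrite (eq_count (a2 := fun w => ((v == a) && (w == b)) || ((v == b) && (w == a)))); last first.
  move=> w; rewrite /joins /= !xpair_eqE.
  by rewrite (eq_sym a v) (eq_sym b w) (eq_sym a w) (eq_sym b v) [(w == a) && _]andbC.
have [->|va] := eqVneq v a; rewrite ?(negPf nab) /=.
  rewrite (eq_count (a2 := pred1 b)); last by move=> w; rewrite /= orbF.
  by rewrite count_uniq_mem // leq_b1.
case: (v == b) => /=; last by rewrite count_pred0.
by rewrite count_uniq_mem // leq_b1.
Qed.

Lemma count_nadj N v p : uniq p -> count (nadj N v) p <= deg N v.
Proof.
move=> up; elim: N => [|e N IH] /=; first by rewrite count_pred0.
rewrite (eq_count (a2 := predU (joins e v) (nadj N v))) //.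
have := count_predUI (joins e v) (nadj N v) p.
by have := count_joins e v up; rewrite /deg /= -/(deg N v); lia.
Qed.

Lemma deg_low N v d : deg N v <= d -> low (nadj N) d v.
Proof. by move=> dv s us; apply: leq_trans dv; exact: count_nadj. Qed.

Lemma sum_deg N : \sum_v deg N v <= 2 * size N.
Proof.
elim: N => [|e N IH] /=; first by rewrite big1.
rewrite /deg /= big_split /= mulnS leq_add //.
rewrite (eq_bigr (fun v => (v == (val e).1) + (v == (val e).2))).
  by rewrite big_split /= -!big_mkcond /= !big_pred1_eq.
move=> v _; rewrite /touches.
have [->|//] := eqVneq v (val e).1.
by case: e => -[a b] /= ab; case: eqVneq ab => // ->; rewrite ltnn.
Qed.

Definition heavy N T : {set 'I_n} := [set v | T <= deg N v].

(** Markov's inequality applied to the handshake sum [sum_deg]. *)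
Lemma card_heavy N T : T * #|heavy N T| <= 2 * size N.
Proof.
apply: leq_trans (sum_deg N).
rewrite mulnC -sum_nat_const [X in _ <= X](bigID (mem (heavy N T))) /=.
apply: leq_trans (leq_addr _ _); apply: leq_sum => v.
by rewrite inE.
Qed.

(** * Graphs built from lists of cycles *)

Definition cyc_edge (cs : seq (seq 'I_n)) v w : bool :=
  has (fun c => (v \in c) && ((next c v == w) || (next c w == v))) cs.

Definition graph_of (cs : seq (seq 'I_n)) : graph n :=
  [ffun e => cyc_edge cs (val e).1 (val e).2].

Lemma next_mem (c : seq 'I_n) v w : next c v = w -> (v \in c) = (w \in c).
Proof. by move=> <-; rewrite mem_next. Qed.

Lemma cyc_edgeC cs : symmetric (cyc_edge cs).
Proof.
move=> v w; apply: eq_has => c; rewrite [_ || (next c v == w)]orbC.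
by case: orP => [[]/eqP/next_mem->|]; rewrite ?andbT ?andbF.
Qed.

Lemma next_neq (c : seq 'I_n) v : uniq c -> 1 < size c -> v \in c -> next c v != v.
Proof.
move=> uc sc vc; have [i c' ec] := rot_to vc.
rewrite -(next_rot i) // ec.
move: uc sc; rewrite -(rot_uniq i) -(size_rot i) ec.
case: c' {ec} => [|w c'] //=; rewrite eqxx inE negb_or => /andP[/andP[vw _] _] _.
by rewrite eq_sym.
Qed.

(** A graph has no bit for a loop, so [cyc_edge] must be irreflexive; a cycle of length 1 would
    break this, since its vertex is its own successor. *)
Lemma adj_graph_of cs : uniq (flatten cs) -> all (fun c => 1 < size c) cs ->
  forall v w, adj (graph_of cs) v w = cyc_edge cs v w.
Proof.
move=> ucs scs v w; apply/existsP/idP => [[e]|].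
  rewrite ffunE => /andP[/orP[] /eqP-> //=]; by rewrite cyc_edgeC.
move=> evw.
have nvw : v != w.
  case/hasP: evw => c cc /andP[vc].
  have uc : uniq c.
    elim: cs ucs cc {scs} => //= c0 cs IH; rewrite cat_uniq inE => /and3P[u0 _ us].
    by case/orP => [/eqP->//|]; exact: IH.
  have nv := next_neq uc (allP scs _ cc) vc.
  by apply: contraL => /eqP <-; rewrite orbb.
have := neq_ltn v w; rewrite -val_eqE /= in nvw; rewrite nvw => /esym/orP[] lt.
  by exists (exist _ (v, w) lt); rewrite eqxx ffunE.
by exists (exist _ (w, v) lt); rewrite eqxx orbT ffunE /= cyc_edgeC.
Qed.

Lemma cycle_union_graph_of cs j m : 1 < m -> size cs = j ->
  all (fun c => size c == m) cs -> perm_eq (flatten cs) (enum 'I_n) ->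
  cycle_union (graph_of cs) j m.
Proof.
move=> m1 scs acs pcs; exists cs; split => // v w; apply: adj_graph_of.
  by rewrite (perm_uniq pcs) enum_uniq.
by apply: sub_all acs => c /eqP->.
Qed.

Lemma graph_of_avoid N cs e : all (cycle (fun v w => ~~ nadj N v w)) cs ->
  e \in N -> graph_of cs e = false.
Proof.
move=> ccs eN; rewrite ffunE; apply/hasPn => c cc; apply/negP => /andP[vc].
have h v : v \in c -> ~~ nadj N v (next c v) by exact: (next_cycle (allP ccs _ cc)).
case/orP => /eqP E.
  have /hasPn/(_ _ eN) := h _ vc.
  by rewrite E /joins -surjective_pairing eqxx.
have /hasPn/(_ _ eN) : ~~ nadj N (val e).2 (next c (val e).2).
  by apply: h; rewrite (next_mem E).
by rewrite E /joins -surjective_pairing eqxx orbT.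
Qed.

(** [pairmap pair x p] lists the steps of the path [x :: p], oriented along it. *)
Lemma pairmap_split v w x p : (v, w) \in pairmap pair x p ->
  exists l r, x :: p = l ++ [:: v, w & r].
Proof.
elim: p x => //= y p IH x; rewrite inE => /orP[/eqP[-> ->]|/IH[l [r ->]]].
  by exists [::], p.
by exists (x :: l), r.
Qed.

Lemma next_pairmap v w x p r : uniq (x :: p ++ r) ->
  (v, w) \in pairmap pair x p -> next (x :: p ++ r) v = w.
Proof.
rewrite -cat_cons => u /pairmap_split[l [q E]].
move: u; rewrite E -catA => u; rewrite -(next_rot (size l) u) rot_size_cat /=.
by rewrite eqxx.
Qed.

Definition on_path x p (e : vpair n) : bool :=
  (val e \in pairmap pair x p) || (((val e).2, (val e).1) \in pairmap pair x p).

Lemma graph_of_path x p r cs e : uniq (x :: p ++ r) -> on_path x p e ->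
  graph_of ((x :: p ++ r) :: cs) e.
Proof.
move=> u; rewrite /on_path [val e]surjective_pairing ffunE.
have memp v w : (v, w) \in pairmap pair x p -> v \in x :: p ++ r.
  move=> /pairmap_split[l [q E]]; rewrite -cat_cons E !mem_cat inE eqxx.
  by rewrite orbT.
case/orP => h; apply/hasP; exists (x :: p ++ r); rewrite ?mem_head //.
  by rewrite (memp _ _ h) (next_pairmap u h) eqxx.
have h' := next_pairmap u h.
by rewrite h' eqxx orbT andbT -(next_mem h') (memp _ _ h).
Qed.

Lemma path_closed (T : eqType) (e : rel T) (a : pred T) (s : seq T) :
  (forall y z : T, e y z -> a y -> a z) -> forall z, a z -> path e z s -> all a s.
Proof.
move=> ha; elim: s => //= y s IH z az /andP[/ha/(_ az) ay /(IH _ ay)->].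
by rewrite ay.
Qed.

(* The first of the k cycles is a proper set of vertices closed under adjacency. *)
Lemma not_ham_k_cycles k (g : graph n) : 1 < k -> 3 * k <= n ->
  k_cycles k g -> ~ ham_cycle g.
Proof.
move=> k1 hn [cs [scs acs pcs adjcs]] [l [sl al pl adjl]].
case: l sl al pl adjl => [|c []] //= _.
rewrite cats0 andbT => /eqP sc pc adjl.
have adjc v w : adj g v w = (v \in c) && ((next c v == w) || (next c w == v)).
  by rewrite adjl orbF.
case: cs scs acs pcs adjcs => [|c1 cs] /=; first by lia.
move=> scs /andP[/eqP sc1 _] pcs adjcs.
have ucs : uniq (c1 ++ flatten cs) by rewrite (perm_uniq pcs) enum_uniq.
have nk : 2 < n %/ k by rewrite leq_divRL //; lia.
have uc : uniq c by rewrite (perm_uniq pc) enum_uniq.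
have memc v : v \in c by rewrite (perm_mem pc) mem_enum.
have closed v w : next c v = w -> v \in c1 -> w \in c1.
  move=> vw vc1; have : adj g v w by rewrite adjc memc vw eqxx.
  rewrite adjcs => /orP[/andP[_ /orP[]/eqP/next_mem E]|]; [by rewrite -E|by rewrite E|].
  case/hasP => c2 c2cs /andP[vc2 _]; exfalso.
  have vf : v \in flatten cs by apply/flattenP; exists c2.
  by move: ucs; rewrite cat_uniq => /and3P[_ /hasPn/(_ v vf)]; rewrite vc1.
case: c1 sc1 closed {pcs adjcs} ucs => [|z c1] sc1 closed ucs; first by rewrite -sc1 in nk.
have [i c' ec] := rot_to (memc z).
(* Following the Hamiltonian cycle from [z] never leaves the closed set [z :: c1], so all [n]
   vertices would lie among its [n %/ k]. *)
have : all [in z :: c1] (z :: c').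
  rewrite /= mem_head /=.
  have := cycle_next (p := rot i c); rewrite rot_uniq => /(_ uc).
  rewrite {2}ec /= rcons_path => /andP[pc' _].
  apply: path_closed pc'; last exact: mem_head.
  by move=> y w /eqP; rewrite next_rot //; exact: closed.
move/allP/uniq_leq_size; rewrite -ec rot_uniq size_rot sc sc1 => /(_ uc).
have : n %/ k < n by apply: ltn_Pdiv; lia.
by lia.
Qed.

End Graphs.

(** * The adversary and its path *)

Section Adversary.
Variables (n T : nat).
Implicit Types (N : seq (vpair n)) (x y v w : 'I_n) (p : seq 'I_n).

Notation good N := (fun v w => ~~ nadj N v w).

(** The adversary adds vertices only at the two ends and never reverses the path, so oriented steps
    can be compared. *)
Definition extends x p x' p' : Prop :=
  {subset pairmap pair x p <= pairmap pair x' p'}.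

Lemma extends_cat x p q : extends x p x (p ++ q).
Proof. by move=> e h; rewrite pairmap_cat mem_cat h. Qed.

Lemma extends_cons x p w : extends x p w (x :: p).
Proof. by move=> e h; rewrite /= inE h orbT. Qed.

Lemma extends_on_path x p x' p' e : extends x p x' p' -> on_path x p e ->
  on_path x' p' e.
Proof. by move=> h /orP[]/h h'; rewrite /on_path h' ?orbT. Qed.

Lemma path_good_cons N x p e : path (good N) x p -> ~~ on_path x p e ->
  path (good (e :: N)) x p.
Proof.
elim: p x => //= y p IH x /andP[gxy gp]; rewrite /on_path /= !inE !negb_or.
case/andP => /andP[h1 h2] /andP[h3 h4].
rewrite IH //; last by rewrite /on_path negb_or h2.
rewrite gxy !andbT h1 /=.
by apply: contra h3; case: (val e) => a b; rewrite !xpair_eqE andbC.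
Qed.

(** The degree bound is [T] rather than [T.-1] because this is used right after an edge joins [N],
    when a vertex not yet covered may just have reached degree [T]. *)
Lemma fresh_vertex N a b p : deg N a <= T -> deg N b <= T -> size p + 2 * T < n ->
  exists v, [/\ v \notin p, ~~ nadj N a v & ~~ nadj N b v].
Proof.
move=> da db szp.
have [|||| v [vr nav nbv]] :=
    @low_avoid2 _ (nadj N) T a b [seq v <- enum 'I_n | v \notin p].
- exact: deg_low.
- exact: deg_low.
- by rewrite filter_uniq // enum_uniq.
- rewrite size_filter; have := count_predC [in p] (enum 'I_n).
  rewrite size_enum_ord.
  have : count [in p] (enum 'I_n) <= size p.
    rewrite -size_filter; apply: uniq_leq_size.
      by rewrite filter_uniq // enum_uniq.
    by move=> v; rewrite mem_filter => /andP[].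
  have -> : count (fun v => v \notin p) (enum 'I_n) = count (predC [in p]) (enum 'I_n).
    exact: eq_count.
  by rewrite /=; lia.
by exists v; move: vr; rewrite mem_filter => /andP[].
Qed.

(* The vertices of [Z] are interior to the path [x :: p], so that both of their
   edges are decided. *)
Definition committed N (Z : {set 'I_n}) x p : Prop :=
  [/\ uniq (x :: p), path (good N) x p, {subset Z <= x :: p} &
      x \notin Z /\ last x p \notin Z].

Lemma reach_vertex N Z x p u : committed N Z x p -> u \notin Z ->
  (forall v, v \notin Z -> deg N v <= T) -> size p + 2 + 2 * T < n ->
  exists q, [/\ committed N Z x (p ++ q), u \in x :: p ++ q, size q <= 2 &
                u \in x :: p -> q = [::]].
Proof.
move=> cp uZ degZ szp; case: (cp) => up gp Zp [xZ lZ].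
have [uxp|uxp] := boolP (u \in x :: p).
  by exists [::]; rewrite cats0; split.
have [v [vp nlv nuv]] := @fresh_vertex N (last x p) u (u :: x :: p)
  (degZ _ lZ) (degZ _ uZ) ltac:(by move=> /=; lia).
exists [:: v; u]; split => //=; last by rewrite inE mem_cat !inE eqxx !orbT.
split.
- rewrite -cat_cons cat_uniq up /= andbT !inE.
  move: vp uxp; rewrite !inE !negb_or => /and3P[vu vx vp] /andP[ux up'].
  by rewrite vx vp ux up' vu.
- by rewrite cat_path gp /= nlv andbT nadjC.
- by move=> z /Zp; rewrite -cat_cons mem_cat => ->.
- by rewrite last_cat.
Qed.

Lemma leave_last N Z x p u : committed N Z x p -> u \in x :: p -> u \notin Z ->
  (forall v, v \notin Z -> deg N v <= T) -> size p + 1 + 2 * T < n ->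
  exists q, [/\ committed N Z x (p ++ q), size q <= 1 & last x (p ++ q) != u].
Proof.
move=> cp uxp uZ degZ szp; case: (cp) => up gp Zp [xZ lZ].
have [lu|lu] := eqVneq (last x p) u; last by exists [::]; rewrite cats0; split.
have [w [wp nuw _]] := @fresh_vertex N u u (x :: p) (degZ _ uZ) (degZ _ uZ)
  ltac:(by move=> /=; lia).
exists [:: w]; split => //; last first.
  by rewrite last_cat /=; apply: contraNneq wp => ->.
split.
- by rewrite -cat_cons cat_uniq up /= orbF andbT.
- by rewrite cat_path gp /= lu nuw.
- by move=> z /Zp; rewrite -cat_cons mem_cat => ->.
- by rewrite last_cat /=; split=> //; apply: contra wp; exact: Zp.
Qed.

(** If [u] is not [x], at most two vertices reach it and one more moves the end past it. If [u] is
    [x], reaching is free, at most one vertex is appended, and one is put in front. *)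
Lemma cover_vertex N Z x p u : committed N Z x p -> u \notin Z ->
  (forall v, v \notin Z -> deg N v <= T) -> size p + 4 + 2 * T < n ->
  exists x' p', [/\ committed N (u |: Z) x' p', size p' <= size p + 3 &
                    extends x p x' p'].
Proof.
move=> cp uZ degZ szp.
have [|q [c1 uq sq q0]] := reach_vertex cp uZ degZ; first by lia.
have [|q' [c2 sq' lu]] := leave_last c1 uq uZ degZ; first by rewrite size_cat; lia.
have ext : extends x p x ((p ++ q) ++ q') by rewrite -catA; exact: extends_cat.
have uq' : u \in x :: (p ++ q) ++ q' by rewrite -cat_cons mem_cat uq.
case: c2 => up gp Zp [xZ lZ].
have [ux|ux] := eqVneq x u; last first.
  exists x, ((p ++ q) ++ q'); split => //; last first.
    by rewrite !size_cat; lia.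
  split=> //; first by move=> z /setU1P[->//|/Zp].
  by rewrite !inE !negb_or ux xZ lu lZ.
rewrite q0 ?cats0 in uq' ext up gp Zp lZ lu; last by rewrite ux mem_head.
have [w [wp nuw _]] := @fresh_vertex N u u (x :: p ++ q') (degZ _ uZ) (degZ _ uZ)
  ltac:(by rewrite /= size_cat; lia).
exists w, (x :: p ++ q'); split; last 1 first.
- by move=> e /ext; exact: extends_cons.
- split=> //.
  + by rewrite cons_uniq wp.
  + by rewrite /= gp nadjC ux nuw.
  + by move=> z /setU1P[->|/Zp zp]; rewrite [_ \in w :: _]inE ?uq' ?zp orbT.
  rewrite /= !inE !negb_or lu lZ; split=> //.
  apply/andP; split; first by apply: contraNneq wp => ->.
  by apply: contra wp; exact: Zp.
by rewrite /= size_cat; lia.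
Qed.

(** Induction on the number of heavy vertices outside [Z]. While one is missing,
    [size p + 3 <= 3 * #|heavy N T|], so the last hypothesis leaves the room that [cover_vertex]
    asks for. *)
Lemma cover_heavy N (Z : {set 'I_n}) x p : committed N Z x p ->
  size p <= 3 * #|Z| -> Z \subset heavy N T ->
  (forall v, v \notin Z -> deg N v <= T) -> 3 * #|heavy N T| + 2 + 2 * T <= n ->
  exists x' p', [/\ committed N (heavy N T) x' p', size p' <= 3 * #|heavy N T| &
                    extends x p x' p'].
Proof.
move=> + + + + szn; have [j] := ubnP #|heavy N T :\: Z|.
elim: j Z x p => // j IH Z x p ltj cp szp sub degZ.
have [h0|] := set_0Vmem (heavy N T :\: Z).
  have E : Z = heavy N T.
    by apply/eqP; rewrite eqEsubset sub -setD_eq0 h0 eqxx.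
  by exists x, p; rewrite -E; split.
case=> u /[!inE] /andP[uZ du].
have subu : u |: Z \subset heavy N T by rewrite subUset sub1set inE du.
have cu : #|u |: Z| = #|Z|.+1 by rewrite cardsU1 uZ.
have := subset_leq_card subu; rewrite cu => ltZ.
have [|x' [p' [c' sz' e']]] := cover_vertex cp uZ degZ; first by lia.
have [|||x2 [p2 [c2 sz2 e2]]] := IH _ _ _ _ c' _ subu.
- rewrite ltnS in ltj; apply: leq_trans ltj; apply: proper_card; apply/properP; split.
    by apply: setDS; exact: subsetUr.
  by exists u; rewrite !inE ?uZ ?du ?eqxx.
- by rewrite cu; lia.
- by move=> v; rewrite !inE negb_or => /andP[_]; exact: degZ.
by exists x2, p2; split => // e /e' /e2.
Qed.

(** Induction on the tree. A queried edge of the path is answered yes without any change of state;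
    any other edge is answered no, joins [N], and the newly heavy vertices are covered. As [N] and
    the path only grow, a graph agreeing with the final state follows the branch taken. *)
Lemma adversary d :
  (forall N, 0 < size N <= d -> 3 * #|heavy N T| + 2 + 2 * T <= n) ->
  forall (t : dtree (vpair n)) N x p, committed N (heavy N T) x p ->
  size p <= 3 * #|heavy N T| -> size N + dt_depth t <= d ->
  exists N' x' p' b,
    [/\ committed N' (heavy N' T) x' p', size p' <= 3 * #|heavy N' T|,
        size N' <= d, {subset N <= N'} /\ extends x p x' p' &
        forall g : graph n, (forall e, e \in N' -> g e = false) ->
          (forall e, on_path x' p' e -> g e) -> dt_eval t g = b].
Proof.
move=> hd; elim=> [b|e t0 IH0 t1 IH1] N x p cp szp szd /=.
  by exists N, x, p, b; split => //; [rewrite addn0 in szd|split].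
have [ep|ep] := boolP (on_path x p e).
  have [|N' [x' [p' [b [c' sz' szN' [sN sp] ev]]]]] := IH1 N x p cp szp.
    by move: szd => /=; lia.
  exists N', x', p', b; split => // g gN gp.
  by rewrite (gp e (extends_on_path sp ep)) ev.
have sub : heavy N T \subset heavy (e :: N) T.
  by apply/subsetP => v; rewrite !inE /deg /=; lia.
case: cp => up gp Zp xZ.
have [|||x1 [p1 [c1 sz1 e1]]] := @cover_heavy (e :: N) (heavy N T) x p _ szp sub.
- by split=> //; exact: path_good_cons.
- by move=> v; rewrite inE /deg /=; case: (touches v e); lia.
- by apply: hd; move: szd => /=; lia.
have [|N' [x' [p' [b [c' sz' szN' [sN sp] ev]]]]] := IH0 _ _ _ c1 sz1.
  by move: szd => /=; lia.
exists N', x', p', b; split => //.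
  by split=> z hz; [apply: sN; rewrite inE hz orbT|exact/sp/e1].
by move=> g gN gp'; rewrite (gN e) ?ev //; apply: sN; exact: mem_head.
Qed.

Lemma consistent_cycles N x p j m : 0 < T -> committed N (heavy N T) x p ->
  n = j.+1 * m -> 4 * T.-1 + 1 + size p < m ->
  exists2 g : graph n, cycle_union g j.+1 m &
    (forall e, e \in N -> g e = false) /\ (forall e, on_path x p e -> g e).
Proof.
move=> T0 [up gp Zp [xZ lZ]] en szm.
have lowZ v : v \notin heavy N T -> low (nadj N) T.-1 v.
  by rewrite inE => h; apply: deg_low; lia.
pose s := [seq v <- enum 'I_n | v \notin x :: p].
have perms : perm_eq (x :: p ++ s) (enum 'I_n).
  apply: uniq_perm; rewrite ?enum_uniq //.
    rewrite -cat_cons cat_uniq up filter_uniq ?enum_uniq // andbT.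
    by apply/hasPn => v; rewrite mem_filter => /andP[].
  move=> v; rewrite -cat_cons mem_cat mem_filter mem_enum.
  by rewrite andbT orbN.
have szs : size s = n - size p - 1.
  by have := perm_size perms; rewrite /= size_cat size_enum_ord; lia.
(* The first cycle consists of the [size p + 1] path vertices and [l] others. The size hypothesis
   amounts to [4 * T.-1 < l], as [close_cycle] requires. *)
pose l := m - size p - 1.
have us : uniq s by rewrite filter_uniq // enum_uniq.
have lows v : v \in s -> low (nadj N) T.-1 v.
  by rewrite mem_filter => /andP[vp _]; apply: lowZ; apply: contra vp; exact: Zp.
have szl : size (take l s) = l by rewrite size_takel // szs /l; lia.
have es := cat_take_drop l s.
have uxs : uniq (x :: p ++ s) by rewrite (perm_uniq perms) enum_uniq.
have uxl : uniq (x :: p ++ take l s).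
  by move: uxs; rewrite -{1}es catA -cat_cons cat_uniq => /and3P[].
have [||r pr cr] := @close_cycle _ (nadj N) T.-1 (@nadjC n N) x p (take l s) _ gp uxl.
- move=> v; rewrite !inE => /or3P[/eqP->|/eqP->|vs]; try exact: lowZ.
  exact/lows/(mem_take vs).
- by rewrite szl /l; lia.
have [||||cs [scs acs pcs ccs]] :=
    @cycles_cover _ (nadj N) T.-1 (@nadjC n N) m j (drop l s).
- by lia.
- by move=> v /mem_drop; exact: lows.
- exact: drop_uniq.
- by rewrite size_drop szs /l; lia.
exists (graph_of ((x :: p ++ r) :: cs)); last split.
- apply: cycle_union_graph_of => /=.
  + by lia.
  + by rewrite scs.
  + by rewrite acs andbT size_cat (perm_size pr) szl /l; apply/eqP; lia.
  rewrite -(permPr perms) perm_cons -catA perm_cat2l -es.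
  exact: perm_cat.
- by move=> e; apply: graph_of_avoid; rewrite /= in cr *; rewrite cr.
- move=> e; apply: graph_of_path.
  by rewrite -(perm_uniq (s1 := x :: p ++ take l s)) // perm_cons perm_cat2l perm_sym.
Qed.

End Adversary.

(** * Choice of the threshold, and the lower bound *)

(** Here [d] counts the no answers and [z] the heavy vertices. With [m = 8q + r], the hypotheses
    give [64qz < m^2], so [z] is about [q] at most and the first left side is about [7q]. *)
Lemma threshold_bound m d z : 2 < m -> 128 * d < m ^ 2 ->
  maxn 1 (m %/ 8) * z <= 2 * d ->
  4 * (maxn 1 (m %/ 8)).-1 + 1 + 3 * z < m /\
  (0 < d -> 3 * z + 2 + 2 * maxn 1 (m %/ 8) <= 2 * m).
Proof.
move=> m3 hd hz; have em := divn_eq m 8; have hr := ltn_pmod m (isT : 0 < 8).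
set q := m %/ 8 in em hz *; set r := m %% 8 in em hr.
have [d0|d0] := posnP d.
  have z0 : z = 0 by rewrite d0 in hz; case: (z) hz => // z'; rewrite mulnS; lia.
  by split; lia.
(* Since [m^2 > 128], [m] is at least 12; thus [q] is positive and the maximum is [q]. *)
have m12 : 11 < m by rewrite expnS expn1 in hd; nia.
have eq1 : maxn 1 q = q by lia.
rewrite eq1 in hz *.
have hqz : 64 * (q * z) < 64 * (q * q) + 16 * (q * r) + r * r.
  by rewrite expnS expn1 in hd; nia.
have z2 : z <= q + 2 by nia.
(* For [r <= 1] the estimate [z <= q + 2] is too weak when [q] is small, but then rounding gives
   [z <= q]. *)
have [r1|r1] := leqP r 1; last by split; lia.
have zq : z <= q by nia.
by split; lia.
Qed.

Lemma dtree_depth_lower_bound n k (t : dtree (vpair n)) : 1 < k -> k %| n ->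
  3 * k <= n ->
  (forall g, oneVKCycle_dom k g -> dt_eval t g = oneVKCycle g) ->
  (n %/ k) ^ 2 <= 128 * dt_depth t.
Proof.
move=> k1 kn hn ht; rewrite leqNgt; apply/negP => hd.
set m := n %/ k in hd.
have en : n = k * m by rewrite mulnC divnK.
have m3 : 2 < m by rewrite leq_divRL; lia.
pose T := maxn 1 (m %/ 8).
have bound (N : seq (vpair n)) : size N <= dt_depth t ->
    4 * T.-1 + 1 + 3 * #|heavy N T| < m /\
    (0 < size N -> 3 * #|heavy N T| + 2 + 2 * T <= 2 * m).
  move=> sN; have := card_heavy N T.
  have : 128 * size N < m ^ 2 by lia.
  exact: threshold_bound.
(* This turns the second part of [bound] into the room that [adversary] needs. *)
have mn : 2 * m <= n by rewrite en leq_mul2r k1 orbT.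
have n0 : 0 < n by lia.
(* As [T] is positive, nothing is heavy at the start, so a one-vertex path is a valid initial
   state. *)
have hv0 : heavy [::] T = set0 :> {set 'I_n}.
  by apply/setP => v; rewrite !inE /deg /= /T; lia.
have [||||N [x [p [b [cp szp szN _ ev]]]]] :=
    @adversary n T (dt_depth t) _ t [::] (Ordinal n0) [::].
- by move=> N /andP[N0 /bound[_ /(_ N0)]]; lia.
- by rewrite hv0; split; rewrite ?inE //; move=> v; rewrite inE.
- by [].
- by [].
have [bN _] := bound N szN.
have T0 : 0 < T by rewrite leq_maxl.
have [||g1 h1 [g1N g1p]] := consistent_cycles (j := 0) (m := n) T0 cp; [by lia|by lia|].
have [||g2 h2 [g2N g2p]] := consistent_cycles (j := k.-1) (m := m) T0 cp; [|by lia|].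
  by rewrite prednK //; lia.
rewrite prednK // in h2; last by lia.
have := ht g1 (or_introl h1); rewrite (ev _ g1N g1p).
have := ht g2 (or_intror h2); rewrite (ev _ g2N g2p) => ->.
rewrite /oneVKCycle.
have /classicbP -> : ham_cycle g1 by [].
by move/classicbP; exact: (not_ham_k_cycles k1 hn h2).
Qed.

Lemma D_total_tree (I : finType) (f : {ffun I -> bool} -> bool) :
  exists2 t : dtree I, dt_depth t <= D_total f & dt_computes t f.
Proof.
rewrite /D_total; case: ex_minnP => d /classicbP[t [td tf]] _.
by exists t.
Qed.

Import GRing.Theory Num.Theory.
Local Open Scope ring_scope.

Theorem theorem4p5 (n k : nat) (hk : (2 <= k)%N) (hkn : (k %| n)%N)
  (hcyc : (3 * k <= n)%N) :
  (n ^ 2)%:R / (128 * k ^ 2)%:R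
    <= ((D_partial (@oneVKCycle_dom n k) (@oneVKCycle n))%:R : rat).
Proof.
have k0 : (0 < k)%N by lia.
rewrite ler_pdivrMr ?ltr0n ?muln_gt0 ?expn_gt0 ?k0 //.
rewrite -natrM ler_nat /D_partial.
(* The minimum is attained by a total [f] extending the partial function; an optimal tree for [f] is
   then correct on the whole domain. *)
case: ex_minnP => _ /classicbP[f [fg <-]] _.
have [t td tf] := D_total_tree f.
have := @dtree_depth_lower_bound n k t hk hkn hcyc.
have ht : forall g, oneVKCycle_dom k g -> dt_eval t g = oneVKCycle g.
  by move=> g hg; rewrite tf fg.
move=> /(_ ht) h; rewrite -{1}(divnK hkn) expnMn mulnA leq_pmul2r ?expn_gt0 ?k0 //.
by apply: leq_trans h _; rewrite mulnC leq_mul2r td orbT.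
Qed.
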